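(* Let $\epsilon\in(0,1)$, and let $\mathbb P$ be a partially exchangeable probability distribution on $(\mathcal X\times\{-1,+1\})^{(k+1)N}$. With $\mathbb P$ probability at least $1-\epsilon$, for any $h=1,\dots,N$ and any Support Vector Machine $f\in\mathcal R_h$, $$r_2(f)\le\frac{k+1}{k}\inf_{\lambda>0}\frac{1-\exp\Bigl[-\frac\lambda Nr_1(f)-\frac hN\log\Bigl(\frac{e(k+1)N}{h}\Bigr)-\frac{\log[h(h+1)]-\log(\epsilon)}{N}\Bigr]}{1-\exp(-\frac\lambda N)}-\frac{r_1(f)}{k}.$$
   Context: $N,k\ge1$ are integers, $\mathcal X$ a measurable space, $\mathcal Y=\{-1,+1\}$, $\Omega=(\mathcal X\times\mathcal Y)^{(k+1)N}$ with coordinate process $(X_i,Y_i)_{i=1}^{(k+1)N}$. For $i=1,\dots,N$, $\tau_i:\Omega\to\Omega$ is defined by $\tau_i(\omega)_{i+jN}=\omega_{i+(j-1)N}$ for $j=1,\dots,k$, $\tau_i(\omega)_i=\omega_{i+kN}$, and $\tau_i(\omega)_{m+jN}=\omega_{m+jN}$ for $m\ne i$, $1\le m\le N$, $0\le j\le k$. $\mathbb P$ is partially exchangeable if $\mathbb P\circ\tau_i^{-1}=\mathbb P$ for all $i=1,\dots,N$. The patterns $(X_i)_{i=1}^{(k+1)N}$ and the labels $(Y_i)_{i=1}^N$ are observed. For a classification rule $f$, $$r_1(f)=\frac1N\sum_{i=1}^N\mathbf 1[f(X_i)\ne Y_i],\qquad r_2(f)=\frac1{kN}\sum_{i=N+1}^{(k+1)N}\mathbf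 1[f(X_i)\ne Y_i].$$ $K$ is a symmetric measurable kernel on $\mathcal X$, positive in the sense that $\sum_{i,j}\alpha_iK(x_i,x_j)\alpha_j\ge0$ for all finite families. For a training set $Z'=(x_i,y_i)_{i=1}^n$ (containing both labels), let $\mathcal A=\{\alpha\in\mathbb R_+^n:\sum_i\alpha_iy_i=0\}$ and $F(\alpha)=\sum_{i,j}\alpha_iy_iK(x_i,x_j)y_j\alpha_j-2\sum_i\alpha_i$. $Z'$ is $K$-separable if $\inf_{\mathcal A}F>-\infty$; then the infimum is reached at some $\alpha^*$. The Support Vector Machine defined by $K$ and $Z'$ is $$\hat f_{Z'}(x)=\operatorname{sign}\Bigl(\sum_i\alpha_i^*y_iK(x_i,x)-b^*\Bigr),\quad b^*=\tfrac12\Bigl\{\sum_j\alpha_j^*y_jK(x_j,x_{i_-})+\sum_j\alpha_j^*y_jK(x_j,x_{i_+})\Bigr\},$$ where $i_\pm$ are any indices with $\alpha^*_{i_\pm}>0$, $y_{i_+}=+1$, $y_{i_-}=-1$ (the rule does not depend on these choices). Its margin is $\gamma(Z')=\bigl(\sum_{i,j}\alpha_i^*y_iK(x_i,x_j)y_j\alpha_j^*\bigr)^{-1/2}$ (the inverse norm of the canonical separating direction in feature space). Let $n=(k+1)N$ and let $R\ge0$ be given by $$R^2=\max_{1\le i\le n}\Bigl\{K(X_i,X_i)-\frac2n\sum_{j=1}^nK(X_i,X_j)\Bigr\}+\frac1{n^2}\sum_{j=1}^n\sum_{l=1}^nK(X_j,X_l).$$ For integers $h$, $\gamma_{2h}=(2h-1)^{-1/2}$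 and $\gamma_{2h+1}=\bigl[2h\bigl(1-\frac1{(2h+1)^2}\bigr)\bigr]^{-1/2}$ (so $\gamma_1=+\infty$). Finally, for $h=1,\dots,N$, $$\mathcal R_h=\bigl\{\hat f_{Z'}:\ Z'=(X_i,y_i')_{i=1}^{(k+1)N}\ \text{is $K$-separable},\ (y'_i)\in\mathcal Y^{(k+1)N},\ \gamma(Z')\ge R\gamma_h\bigr\}.$$ *)

(* Defs.v *)
From mathcomp Require Import all_boot all_order all_algebra.
From mathcomp Require Import all_classical all_reals all_analysis.

Set Implicit Arguments.
Unset Strict Implicit.
Unset Printing Implicit Defensive.

Import Order.TTheory GRing.Theory Num.Theory.

Local Open Scope classical_set_scope.
Local Open Scope ring_scope.

(* The label set {-1, +1} is encoded by bool: true is +1 and false is -1. *)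
Definition label {R : realType} (b : bool) : R := if b then 1 else -1.

(* The convention at 0 is sign 0 = +1. *)
Definition sign_label {R : realType} (r : R) : bool := 0 <= r.

(* Indices start from 0: the 1-based index i + j N, 1 <= i <= N, 0 <= j <= k,
   becomes m = i' + j N with i' = i - 1 < N, so that m %% N = i', and the
   observed labels are those with m < N. *)
Notation sample_space k N T := ((k.+1 * N)%N.-tuple (T * bool)%type).

Definition pattern {k N : nat} {T : Type} (w : sample_space k N T)
  (m : 'I_(k.+1 * N)) : T := (tnth w m).1.

Definition obs_label {k N : nat} {T : Type} (w : sample_space k N T)
  (m : 'I_(k.+1 * N)) : bool := (tnth w m).2.

Section partial_exchangeability.
Variables k N : nat.

(* The coordinate of w that tau i moves to position m. *)
Definition tau_source (i m : nat) : nat :=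
  if (m %% N == i)%N then (if (m < N)%N then m + k * N else m - N)%N else m.

(* tau_source i m is always in range, so the default value is not reached. *)
Definition tau {T : Type} (i : 'I_N) (w : sample_space k N T) :
    sample_space k N T :=
  [tuple nth (tnth w m) w (tau_source i m) | m < (k.+1 * N)%N].

Definition partially_exchangeable {R : realType} {d : measure_display}
    {T : measurableType d} (P : probability (sample_space k N T) R) : Prop :=
  forall (i : 'I_N) (A : set (sample_space k N T)),
    measurable A -> pushforward P (tau i) A = P A.

End partial_exchangeability.

Section error_rates.
Context {R : realType} {k N : nat} {T : Type}.
Implicit Types (w : sample_space k N T) (f : T -> bool).

Definition r1 w f : R :=
  N%:R^-1 * \sum_(m < (k.+1 * N)%N | (m < N)%N)
              (f (pattern w m) != obs_label w m)%:R.

Definition r2 w f : R :=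
  (k * N)%:R^-1 * \sum_(m < (k.+1 * N)%N | (N <= m)%N)
                    (f (pattern w m) != obs_label w m)%:R.

End error_rates.

Section kernel.
Context {R : realType} {d : measure_display} {T : measurableType d}.

Definition positive_kernel (K : T * T -> R) : Prop :=
  [/\ measurable_fun [set: T * T] K,
      forall x y : T, K (x, y) = K (y, x)
    & forall (n : nat) (x : 'I_n -> T) (a : 'I_n -> R),
        0 <= \sum_(i < n) \sum_(j < n) a i * K (x i, x j) * a j].

End kernel.

Section support_vector_machines.
Context {R : realType} {T : Type} {n : nat}.
Variables (K : T * T -> R) (x : 'I_n -> T) (y : 'I_n -> bool).
Implicit Types (a : 'I_n -> R) (f : T -> bool).

Definition both_labels : Prop := (exists i, y i = true) /\ (exists i, y i = false).

Definition dual_set : set ('I_n -> R) :=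
  [set a | (forall i, 0 <= a i) /\ \sum_(i < n) a i * label (y i) = 0].

Definition dual_quad a : R :=
  \sum_(i < n) \sum_(j < n)
    a i * label (y i) * K (x i, x j) * label (y j) * a j.

Definition dual_obj a : R := dual_quad a - 2 * \sum_(i < n) a i.

Definition dual_inf : \bar R := ereal_inf [set (dual_obj a)%:E | a in dual_set].

Definition K_separable : Prop := (-oo < dual_inf)%E.

Definition dual_minimizer a : Prop :=
  dual_set a /\ (dual_obj a)%:E = dual_inf.

Definition svm_score a (z : T) : R :=
  \sum_(j < n) a j * label (y j) * K (x j, z).

Definition svm_threshold a (im ip : 'I_n) : R :=
  2^-1 * (svm_score a (x im) + svm_score a (x ip)).

(* A relation, since neither the minimizer a nor the indices im and ip need be
   unique. *)
Definition is_svm a f : Prop :=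
  dual_minimizer a /\
  exists im ip : 'I_n,
    [/\ 0 < a im /\ 0 < a ip, y im = false, y ip = true
      & f = fun z => sign_label (svm_score a z - svm_threshold a im ip)].

(* The inverse in \bar R, with 0^-1 = +oo. *)
Definition svm_margin a : \bar R := ((Num.sqrt (dual_quad a))%:E^-1)%E.

End support_vector_machines.

Section margin_classes.
Context {R : realType}.

(* The inverse in \bar R gives gamma_ 1 = +oo. *)
Definition gamma_ (h : nat) : \bar R :=
  let m := h./2 in
  ((Num.sqrt (if odd h then (2 * m)%:R * (1 - ((2 * m).+1%:R ^+ 2)^-1)
              else (2 * m)%:R - 1))%:E^-1)%E.

(* The maximum over the finite set of indices is written as a sup. *)
Definition sample_radius {T : Type} {n : nat} (K : T * T -> R)
    (x : 'I_n -> T) : R :=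
  Num.sqrt
    (sup (range (fun i : 'I_n =>
       K (x i, x i) - 2 / n%:R * \sum_(j < n) K (x i, x j)))
     + (n%:R ^+ 2)^-1 * \sum_(j < n) \sum_(l < n) K (x j, x l)).

Definition margin_class {T : Type} {n : nat} (K : T * T -> R) (x : 'I_n -> T)
    (h : nat) : set (T -> bool) :=
  [set f | exists (y : 'I_n -> bool) (a : 'I_n -> R),
     [/\ both_labels y, K_separable K x y, is_svm K x y a f
       & ((sample_radius K x)%:E * gamma_ h <= svm_margin K x y a)%E]].

End margin_classes.

(* Inner probability: no measurability of the event A is presupposed. *)
Definition with_probability_at_least {R : realType} {d : measure_display}
    {S : measurableType d} (P : probability S R) (p : R) (A : set S) : Prop :=
  exists E : set S, [/\ measurable E, (p%:E <= P E)%E & E `<=` A].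

(* Main.v *)
Require Import Defs.
From mathcomp Require Import all_boot all_order all_algebra fingroup perm.
From mathcomp Require Import all_classical all_reals all_analysis.
From mathcomp Require Import measurable_realfun ring lra zify.

(** The argument combines a conditional deviation inequality, valid for a fixed
    labelling of the whole sample, with a union bound over the few labellings
    that a Support Vector Machine of large margin can produce.

    Deviations. Fix the sample and a vector of errors [err]. Cyclic shifts of
    the columns [i, i + N, ..., i + kN] preserve the law of the sample, and a
    uniformly random family of shifts, one for each column, makes the N training
    errors independent, with means the column averages of [err]. For q in (0,1),
    the mean of q ^ (number of training errors) is thus a product over the
    columns, at most (1 - p (1 - q)) ^ N by the inequality between arithmetic
    and geometric means, p being the average of [err] over the whole sample
    ([sum_multishift_le]). Markov's inequality bounds the proportion of shifts
    for which C (1 - p (1 - q)) ^ N < q ^ (number of training errors) by 1 / C.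
    This remains true when q is allowed to depend on the shift
    ([count_deviating]): p does not change under shifts, and the parameter q
    that detects the largest number of training errors detects all others. For
    q = exp (- lambda / N) this is the deviation bound for all lambda at once.

    Counting. The optimality conditions of the dual problem ([svm_kkt]) say that
    the SVM separates its training set with functional margin 1, so its values
    on the sample are the labels y' it was trained with. A separating direction
    of squared norm Q forces, for any h + 1 sample points split into two halves,
    the centres of gravity of the halves to be at distance at least
    2 / sqrt Q, hence at least 2 R gamma_h for the radius R of the sample. The labellings with this last
    property are called [wide]. Averaging the squared distance over all ways of
    splitting the h + 1 points ([exists_perm_bform_le]) yields 4 gamma_(h+1)^2
    times their variance, which is at most 4 R^2 gamma_(h+1)^2. As
    gamma_(h+1) < gamma_h, wide labellings shatter no set of h + 1 points
    ([wide_not_shattered]), and by the Sauer-Shelah lemma there are at most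
    (e (k+1) N / h) ^ h of them.

    Conclusion. The set of wide labellings is carried along by permutations of
    the sample, so the union bound can be done on each orbit of the shifts: with
    C = (e (k+1) N / h) ^ h * h (h + 1) / eps, the exceptional proportion is at
    most the sum over h of eps / (h (h + 1)), that is at most eps
    ([orbit_count_deviation_event]). Integration against the invariant law
    concludes. Wide labellings, unlike the set of labellings realised by an SVM,
    are defined by finitely many inequalities between values of the kernel; this
    makes the exceptional event measurable. *)

Set Implicit Arguments.
Unset Strict Implicit.
Unset Printing Implicit Defensive.

Import Order.TTheory GRing.Theory Num.Theory.

(** * Sauer-Shelah lemma *)

Section sauer_shelah.
(* The set operations of this part are those of finite sets. *)
Import mathcomp.boot.fintype mathcomp.boot.finset.
Local Open Scope set_scope.
Variable I : finType.
Implicit Types (F : {set {set I}}) (A B C S : {set I}).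

Definition shatters F B :=
  [forall C : {set I}, (C \subset B) ==> [exists A in F, A :&: B == C]].

Lemma shattersP F B :
  reflect (forall C, C \subset B -> exists2 A, A \in F & A :&: B = C)
          (shatters F B).
Proof.
apply: (iffP forallP) => sh C.
  by move=> CB; have := sh C; rewrite CB /= => /exists_inP[A AF /eqP]; exists A.
apply/implyP => CB; have [A AF AB] := sh C CB.
by apply/exists_inP; exists A => //; apply/eqP.
Qed.

(** This form of the Sauer-Shelah lemma, due to Pajor, has an immediate
    induction: sort the members of F according to whether they contain a point
    x, and delete x. A set shattered by one of the two families is shattered by F,
    and a set B shattered by both gives one more shattered set, [x |: B]. *)
Lemma card_family_le_shattered S F : (forall A, A \in F -> A \subset S) ->
  #|F| <= #|[set B | shatters F B]|.
Proof.
have [m] := ubnP #|S|; elim: m S F => // m IHm S F; rewrite ltnS => Sm FS.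
have [S0|[x xS]] := set_0Vmem S.
  have [->|[A AF]] := set_0Vmem F; first by rewrite cards0.
  have A0 : A = set0 by apply/eqP; rewrite -subset0 -S0 FS.
  have sF : F \subset [set set0].
    by apply/subsetP => B /FS; rewrite S0 subset0 inE.
  apply: leq_trans (subset_leq_card sF) _; rewrite cards1 card_gt0.
  apply/set0Pn; exists set0; rewrite inE; apply/shattersP => C.
  by rewrite subset0 => /eqP ->; exists A => //; rewrite A0 setI0.
pose F0 := [set A in F | x \notin A].
pose F1 := [set A : {set I} | (x \notin A) && (x |: A \in F)].
have cF : #|F| = #|F0| + #|F1|.
  rewrite -(cardsID [set A : {set I} | x \in A] F) addnC; congr (_ + _).
    by apply: eq_card => A; rewrite !inE andbC.
  have -> : F :&: [set A : {set I} | x \in A] = (setU [set x]) @: F1.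
    apply/setP => A; rewrite !inE; apply/andP/imsetP => [[AF xA]|].
      by exists (A :\ x); rewrite ?inE ?eqxx ?setD1K.
    by case=> B; rewrite !inE => /andP[xB BF] ->; rewrite setU11.
  rewrite card_in_imset // => A B; rewrite !inE => /andP[xA _] /andP[xB _] AB.
  by rewrite -(setU1K xA) -(setU1K xB) AB.
have Sx : #|S :\ x| < m by move: Sm; rewrite (cardsD1 x S) xS.
have sub0 A : A \in F0 -> A \subset S :\ x.
  by rewrite inE subsetD1 => /andP[/FS -> ->].
have sub1 A : A \in F1 -> A \subset S :\ x.
  rewrite inE subsetD1 => /andP[-> /FS xAS]; rewrite andbT.
  exact: subset_trans (subsetUr _ _) xAS.
have le0 := IHm _ _ Sx sub0; have le1 := IHm _ _ Sx sub1.
pose sh0 := [set B | shatters F0 B]; pose sh1 := [set B | shatters F1 B].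
have notin (G : {set {set I}}) B :
    (forall A, A \in G -> A \subset S :\ x) -> shatters G B -> x \notin B.
  move=> GS /shattersP/(_ B (subxx _))[A /GS]; rewrite subsetD1.
  by move=> /andP[_ xA] <-; rewrite inE negb_and xA.
have lift_inj : {in sh0 :&: sh1 &, injective (setU [set x])}.
  move=> A B; rewrite !inE => /andP[/(notin _ _ sub0) xA _].
  move=> /andP[/(notin _ _ sub0) xB _] AB.
  by rewrite -(setU1K xA) -(setU1K xB) AB.
have shU : (sh0 :|: sh1) :|: setU [set x] @: (sh0 :&: sh1)
    \subset [set B | shatters F B].
  apply/subsetP => B; rewrite !inE -orbA.
  move=> /or3P[/[dup] /(notin _ _ sub0) xB|/[dup] /(notin _ _ sub1) xB|].
  - move=> /shattersP sB; apply/shattersP => C /sB[A].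
    rewrite inE => /andP[AF _].
    by exists A.
  - move=> /shattersP sB; apply/shattersP => C /sB[A]; rewrite inE.
    move=> /andP[xA AF] <-; exists (x |: A) => //.
    rewrite setIUl; have -> : [set x] :&: B = set0.
      by apply/setP => z; rewrite !inE; case: eqP => //= ->; apply/negbTE.
    by rewrite set0U.
  - case/imsetP => D; rewrite !inE => /andP[s0 s1] -> {B}.
    have xB := notin _ _ sub0 s0.
    apply/shattersP => C CB; have [xC|xC] := boolP (x \in C).
      have /shattersP/(_ (C :\ x)) := s1.
      rewrite subDset => /(_ CB)[A]; rewrite inE => /andP[xA AF] AB.
      exists (x |: A) => //; rewrite -setUIr AB setD1K //.
    have /shattersP/(_ C) := s0.
    have CD : C \subset D.
      apply/subsetP => z zC; have := subsetP CB z zC; rewrite !inE.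
      by case: eqP => // zx; rewrite zx in zC; rewrite zC in xC.
    move=> /(_ CD)[A]; rewrite inE => /andP[AF xA] AB; exists A => //.
    rewrite setIUr AB; have -> : A :&: [set x] = set0.
      by apply/setP => z; rewrite !inE andbC; case: eqP => //= ->; apply/negbTE.
    by rewrite set0U.
rewrite cF; apply: leq_trans (leq_add le0 le1) _.
apply: leq_trans (subset_leq_card shU).
rewrite cardsU [X in _ <= _ - X](_ : _ = 0) ?subn0.
  by rewrite (card_in_imset lift_inj) -/sh0 -/sh1 -cardsUI.
apply/eqP; rewrite cards_eq0; apply/eqP/setP => B; rewrite !inE.
apply/negbTE/negP => /andP[sB /imsetP[C _ BC]].
have xB : x \in B by rewrite BC setU11.
by case/orP: sB => [/(notin _ _ sub0)|/(notin _ _ sub1)]; rewrite xB.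
Qed.

Lemma sauer_shelah F h : (forall B, shatters F B -> #|B| <= h) ->
  #|F| <= \sum_(i < h.+1) 'C(#|I|, i).
Proof.
move=> Fh; have := @card_family_le_shattered setT F (fun A _ => subsetT A).
move=> /leq_trans; apply.
have sub : [set B | shatters F B] \subset [set B : {set I} | #|B| < h.+1].
  by apply/subsetP => B; rewrite !inE ltnS => /Fh.
apply: leq_trans (subset_leq_card sub) _.
rewrite -sum1_card.
rewrite (partition_big (fun B : {set I} => inord #|B| : 'I_h.+1) xpredT) //=.
apply: leq_sum => i _; rewrite sum1_card -(card_draws I i).
apply/subset_leq_card/subsetP => B; rewrite !inE => /andP[].
by rewrite inE => Bh /eqP <-; rewrite inordK.
Qed.

End sauer_shelah.

Local Open Scope classical_set_scope.
Local Open Scope ring_scope.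

(** Multiplied by t ^ h with t = h / n <= 1, the sum is at most the binomial
    expansion of (1 + t) ^ n <= exp (t n) = exp h. *)
Lemma sum_binomial_le_exp (R : realType) (n h : nat) : (0 < h <= n)%N ->
  (\sum_(i < h.+1) 'C(n, i))%N%:R <= (expR 1 * n%:R / h%:R) ^+ h :> R.
Proof.
move=> /andP[h0 hn]; have n0 : (0 < n)%N by exact: leq_trans hn.
set t : R := h%:R / n%:R.
have hR : 0 < h%:R :> R by rewrite ltr0n.
have nR : 0 < n%:R :> R by rewrite ltr0n.
have t0 : 0 < t by rewrite divr_gt0.
have t1 : t <= 1 by rewrite ler_pdivrMr // mul1r ler_nat.
have -> : expR 1 * n%:R / h%:R = expR 1 / t :> R by rewrite /t invf_div mulrA.
rewrite exprMn exprVn ler_pdivlMr ?exprn_gt0 // -expRM_natl mulr1.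
have := @expR_ge1Dx R t.
have t'0 : 0 <= 1 + t by rewrite addr_ge0 // ltW.
move=> /(lerXn2r n); rewrite !nnegrE t'0 expR_ge0 => /(_ isT isT).
rewrite -expRM_natl [in X in (_ <= X) -> _](_ : n%:R * t = h%:R); last first.
  by rewrite mulrC divfK ?gt_eqF.
have hn1 : (h.+1 <= n.+1)%N by [].
apply: le_trans; rewrite exprDn (big_ord_widen _ (fun i => 'C(n, i)) hn1).
rewrite natr_sum mulr_suml big_mkcond; apply: ler_sum => i _.
case: ifP => [ih|_]; last first.
  rewrite mulrn_wge0 ?mulr_ge0 ?exprn_ge0 ?ler01 //; exact: ltW.
rewrite expr1n mul1r -[leRHS]mulr_natl ler_wpM2l // ler_wiXn2l //.
exact: ltW.
Qed.

(** * Positive semidefinite forms *)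

Section quadratic_form.
Variables (R : realType) (I : finType).
Implicit Types (k : I -> I -> R) (u v w : I -> R).

Definition bform k u v : R := \sum_i \sum_j u i * k i j * v j.

Definition psd k : Prop :=
  (forall i j, k i j = k j i) /\ forall u, 0 <= bform k u u.

Lemma bformE k u v : bform k u v = \sum_i u i * \sum_j k i j * v j.
Proof.
apply: eq_bigr => i _; rewrite mulr_sumr.
by apply: eq_bigr => j _; rewrite mulrA.
Qed.

Lemma bformC k u v : psd k -> bform k u v = bform k v u.
Proof.
case=> sym _; rewrite /bform exchange_big; apply: eq_bigr => i _.
by apply: eq_bigr => j _; rewrite (sym j i); ring.
Qed.

Lemma bform_line k u v t : psd k ->
  bform k (fun i => u i + t * v i) (fun i => u i + t * v i)
  = bform k u u + 2 * t * bform k u v + t ^+ 2 * bform k v v.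
Proof.
move=> pk; have -> : 2 * t * bform k u v = t * bform k u v + t * bform k v u.
  by rewrite (bformC u v pk); ring.
rewrite /bform !mulr_sumr -!big_split /=; apply: eq_bigr => i _.
by rewrite !mulr_sumr -!big_split /=; apply: eq_bigr => j _; ring.
Qed.

Lemma cauchy_schwarz k u v : psd k ->
  bform k u v ^+ 2 <= bform k u u * bform k v v.
Proof.
move=> pk; set a := bform k u u; set b := bform k u v; set c := bform k v v.
have q t : 0 <= a + 2 * t * b + t ^+ 2 * c.
  by rewrite -bform_line //; apply pk.2.
have [c0|] := ltP 0 c.
  have := q (- b / c); have -> : a + 2 * (- b / c) * b + (- b / c) ^+ 2 * c
      = (a * c - b ^+ 2) / c by field; rewrite gt_eqF.
  by rewrite pmulr_lge0 ?invr_gt0 // subr_ge0.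
have c0 : 0 <= c by apply pk.2.
move=> c0'; have {c0 c0'} c0 : c = 0 by apply/eqP; rewrite eq_le c0 c0'.
rewrite c0 mulr0 expr2; case: (eqVneq b 0) => [->|b0]; first by rewrite mulr0.
have := q (- (a + 1) / (2 * b)); rewrite c0 mulr0 addr0.
have -> : a + 2 * (- (a + 1) / (2 * b)) * b = -1 by field.
by rewrite lerNr oppr0 ler10.
Qed.

End quadratic_form.

Section transport.
Variables (R : realType) (I J : finType) (e : J -> I).

(** The image of the signed measure [c] by [e]: it turns combinations of the
    points [e j], possibly repeated, into combinations of the points of [I]. *)
Definition transport (c : J -> R) (i : I) : R := \sum_(j | e j == i) c j.

Lemma sum_transport (c : J -> R) (F : I -> R) :
  \sum_i transport c i * F i = \sum_j c j * F (e j).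
Proof.
rewrite [RHS](partition_big e xpredT) //=; apply: eq_bigr => i _.
by rewrite mulr_suml; apply: eq_bigr => j /eqP ->.
Qed.

Lemma bform_transportl k c v :
  bform k (transport c) v = \sum_j c j * \sum_i k (e j) i * v i.
Proof. by rewrite bformE (sum_transport c (fun i => \sum_j k i j * v j)). Qed.

Lemma bform_transport k c :
  bform k (transport c) (transport c) = bform (fun j l => k (e j) (e l)) c c.
Proof.
rewrite bform_transportl bformE; apply: eq_bigr => j _; congr (_ * _).
under eq_bigr do rewrite mulrC.
by rewrite sum_transport; apply: eq_bigr => l _; rewrite mulrC.
Qed.

End transport.

Section permutation_average.
Variables (R : realType) (J : finType) (k : J -> J -> R) (c : J -> R).
Hypotheses (c_sum0 : \sum_j c j = 0) (J_gt1 : (1 < #|J|)%N).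

Let p : R := #|J|%:R.
Let S i j : R := \sum_(s : {perm J}) c (s i) * c (s j).

Let S_tperm i j x y :
  S i j = S (tperm x y i) (tperm x y j).
Proof.
rewrite /S (reindex_inj (mulgI (tperm x y))) /=.
by apply: eq_bigr => s _; rewrite !permM.
Qed.

Let S_diag i : p * S i i = #|{perm J}|%:R * \sum_j c j ^+ 2.
Proof.
have -> : p * S i i = \sum_j S j j.
  rewrite (eq_bigr (fun=> S i i)) ?sumr_const ?mulr_natl // => j _.
  by rewrite (S_tperm i i i j) tpermL.
rewrite /S exchange_big /= (eq_bigr (fun=> \sum_j c j ^+ 2)).
  by rewrite sumr_const mulr_natl.
move=> s _; rewrite [RHS](reindex_perm s) /=.
by apply: eq_bigr => j _; rewrite expr2.
Qed.

Let S_offdiag i j : i != j -> (p - 1) * S i j = - S i i.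
Proof.
move=> ij; have : \sum_l S i l = 0.
  rewrite /S exchange_big /= big1 // => s _; rewrite -mulr_sumr.
  have -> : \sum_l c (s l) = 0 by rewrite -[RHS]c_sum0 [RHS](reindex_perm s).
  by rewrite mulr0.
rewrite (bigD1 i) //= (eq_bigr (fun=> S i j)) => [|l li]; last first.
  by rewrite (S_tperm i j j l) tpermL tpermD // eq_sym.
rewrite sumr_const => /eqP; rewrite addrC addr_eq0 => /eqP <-.
rewrite -mulr_natl; congr (_ * _).
by rewrite cardC1 /p -subn1 natrB // ltnW.
Qed.

(** In feature space, [\sum_j c (s j) x_j] is a difference of weighted means of
    the points, and its mean square over all permutations s is a multiple of
    their variance: since c sums to 0, the mean of [c (s i) * c (s j)] is
    determined by its value for i = j, which gives the ratio -1 / (p - 1). *)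
Lemma exists_perm_bform_le : exists s : {perm J},
  (p - 1) * bform k (c \o s) (c \o s)
  <= (\sum_j c j ^+ 2) * (\sum_j k j j - p^-1 * \sum_i \sum_j k i j).
Proof.
apply: contrapT => /forallNP H.
set V : R := (\sum_j c j ^+ 2)
  * (\sum_j k j j - p^-1 * \sum_i \sum_j k i j) in H.
set N : R := #|{perm J}|%:R.
have p0 : p != 0 by rewrite /p pnatr_eq0 -lt0n ltnW.
have SE i j : (p - 1) * S i j
    = ((i == j)%:R - p^-1) * (N * \sum_l c l ^+ 2).
  rewrite -(S_diag i); case: eqVneq => [<-|ij]; last first.
    by rewrite S_offdiag // sub0r mulNr mulrA mulVf // mul1r.
  by rewrite mulrA [(_ - _) * p]mulrBl mul1r mulVf.
have VE : V = (\sum_l c l ^+ 2) * \sum_i \sum_j ((i == j)%:R - p^-1) * k i j.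
  congr (_ * _); rewrite mulr_sumr -sumrB; apply: eq_bigr => i _; apply/esym.
  rewrite (eq_bigr (fun j => (i == j)%:R * k i j - p^-1 * k i j)) => [|j _].
    rewrite sumrB -mulr_sumr (bigD1 i) //= eqxx mul1r big1 ?addr0 // => j.
    by rewrite eq_sym => /negbTE ->; rewrite mul0r.
  by rewrite mulrBl.
have : \sum_(s : {perm J}) (p - 1) * bform k (c \o s) (c \o s) = N * V.
  rewrite VE mulrA; set A := N * _ in SE *.
  rewrite -mulr_sumr /bform exchange_big !mulr_sumr.
  apply: eq_bigr => i _; rewrite exchange_big !mulr_sumr /=.
  apply: eq_bigr => j _; rewrite mulrA [A * _]mulrC -SE.
  rewrite (eq_bigr (fun s : {perm J} => k i j * (c (s i) * c (s j)))).
    by rewrite -mulr_sumr mulrCA mulrC.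
  by move=> s _; rewrite mulrAC mulrC.
apply/eqP; rewrite gt_eqF // /N mulr_natl -sumr_const.
apply: ltr_sum => [|s _]; last by rewrite ltNge; apply/negP/H.
by apply/hasP; exists 1%g => //; rewrite mem_index_enum.
Qed.

End permutation_average.

(** * Margins, contrasts and spread *)

Section inverse_square_margin.
Variable R : realType.

(** The inverse square of [gamma_ h], which is finite for every h. *)
Definition inv_gamma_sq (h : nat) : R :=
  let m := h./2 in
  if odd h then (2 * m)%:R * (1 - ((2 * m).+1%:R ^+ 2)^-1) else (2 * m)%:R - 1.

(** The two parity cases are instances of 4 a b (h - 1) / h^2, where h = a + b
    is the most balanced splitting of h. *)
Lemma inv_gamma_sqE h : (0 < h)%N ->
  inv_gamma_sq h * h%:R ^+ 2
  = 4 * (h./2)%:R * (h - h./2)%:R * (h%:R - 1).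
Proof.
move=> h0; rewrite /inv_gamma_sq /=; set m := h./2.
have hE : h = (odd h + 2 * m)%N by rewrite mul2n odd_double_half.
case: (odd h) hE => hE.
  have -> : (h - m = m.+1)%N by rewrite hE; lia.
  have -> : h = (2 * m).+1 by rewrite hE; lia.
  by field; rewrite -natrM addrC natr1 pnatr_eq0.
have -> : (h - m = m)%N by rewrite hE add0n mul2n -addnn addnK.
by rewrite hE add0n natrM; ring.
Qed.

Lemma inv_gamma_sq_ltS h : (0 < h)%N -> inv_gamma_sq h < inv_gamma_sq h.+1.
Proof.
move=> h0; rewrite /inv_gamma_sq /= uphalf_half; set m := h./2.
have hE : h = (odd h + 2 * m)%N by rewrite mul2n odd_double_half.
case: (odd h) hE => /= hE; set q : R := ((2 * _).+1%:R ^+ 2)^-1.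
  have q0 : 0 <= q by rewrite invr_ge0 exprn_ge0.
  apply: (@le_lt_trans _ _ (2 * m)%:R).
    by rewrite ler_piMr // lerBlDr lerDl.
  by rewrite mulnDr natrD; lra.
have m0 : 0 < (2 * m)%:R :> R by rewrite ltr0n; move: h0; rewrite hE add0n.
rewrite add0n mulrBr mulr1 ltrD2l ltrN2 /q ltr_pdivrMr ?exprn_gt0 // mul1r.
by rewrite -natr1; nra.
Qed.

Lemma inv_gamma_sq_ge0 h : (0 < h)%N -> 0 <= inv_gamma_sq h.
Proof.
move=> h0; have h2 : 0 < h%:R ^+ 2 :> R by rewrite exprn_gt0 // ltr0n.
rewrite -(pmulr_lge0 _ h2) inv_gamma_sqE // mulr_ge0 // ?mulr_ge0 //.
by rewrite subr_ge0 ler1n.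
Qed.

End inverse_square_margin.

Section contrast.
Variables (R : realType) (p : nat).

(** Weights of the difference between the centre of gravity of the first half of
    p points and that of the remaining ones. *)
Definition contrast (j : 'I_p) : R :=
  if (j < p./2)%N then (p./2)%:R^-1 else - (p - p./2)%:R^-1.

Lemma sum_half_split (x y : R) :
  \sum_(j < p) (if (j < p./2)%N then x else y) = x *+ p./2 + y *+ (p - p./2).
Proof.
have hp : (p./2 <= p)%N by lia.
rewrite -(big_mkord xpredT (fun j => if (j < p./2)%N then x else y)).
rewrite (@big_cat_nat _ _ _ p./2) //= !big_nat.
rewrite (eq_bigr (fun=> x)) => [|j /andP[_ ->] //].
rewrite [X in _ + X](eq_bigr (fun=> y)) => [|j /andP[]]; last first.
  by rewrite leqNgt => /negbTE ->.
by rewrite -!big_nat !sumr_const_nat subn0.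
Qed.

Hypothesis p_gt1 : (1 < p)%N.

Let a0 : (p./2)%:R != 0 :> R. Proof. by rewrite pnatr_eq0; lia. Qed.
Let b0 : (p - p./2)%:R != 0 :> R. Proof. by rewrite pnatr_eq0; lia. Qed.

Let invrMn n : n%:R != 0 :> R -> n%:R^-1 *+ n = 1 :> R.
Proof. by move=> n0; rewrite -[_ *+ n]mulr_natr mulVf. Qed.

Lemma sum_contrast : \sum_j contrast j = 0.
Proof. by rewrite sum_half_split mulNrn !invrMn // subrr. Qed.

Lemma sum_contrast_sq :
  \sum_j contrast j ^+ 2 = p%:R / ((p./2)%:R * (p - p./2)%:R).
Proof.
rewrite (eq_bigr (fun j : 'I_p => if (j < p./2)%N then (p./2)%:R^-1 ^+ 2
    else (p - p./2)%:R^-1 ^+ 2)) => [|j _]; last first.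
  by rewrite /contrast; case: ifP => // _; rewrite sqrrN.
rewrite sum_half_split -[_ *+ p./2]mulr_natr -[_ *+ (p - _)]mulr_natr.
have hp : (p./2 <= p)%N by lia.
have -> : p%:R = (p./2)%:R + (p - p./2)%:R :> R by rewrite -natrD subnKC.
by field; apply/andP.
Qed.

(** The offset b disappears because a contrast sums to 0. *)
Lemma contrast_separated (g : 'I_p -> R) (b : R) :
  (forall j : 'I_p, (j < p./2)%N -> 1 <= g j - b) ->
  (forall j : 'I_p, (p./2 <= j)%N -> g j - b <= -1) ->
  2 <= \sum_j contrast j * g j.
Proof.
move=> gp gm; rewrite (_ : \sum_j _ = \sum_j contrast j * (g j - b)); last first.
  under [RHS]eq_bigr do rewrite mulrBr.
  by rewrite sumrB -mulr_suml sum_contrast mul0r subr0.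
have -> : 2 = \sum_(j < p) (if (j < p./2)%N then (p./2)%:R^-1
                           else (p - p./2)%:R^-1) :> R.
  by rewrite sum_half_split !invrMn.
apply: ler_sum => j _; rewrite /contrast; case: ltnP => hj.
  by rewrite ler_peMr ?invr_ge0 // gp.
by rewrite mulNr -mulrN ler_peMr ?invr_ge0 // lerNr gm.
Qed.

End contrast.

Section spread.
Variables (R : realType) (I : finType) (k : I -> I -> R).

Definition centered (i j : I) : R := (j == i)%:R - #|I|%:R^-1.

(** For a Gram matrix [k], the squared distance in feature space between the
    point i and the centre of gravity of all the points. *)
Definition spread (i : I) : R := bform k (centered i) (centered i).

Hypothesis k_psd : psd k.

Lemma bform_delta i v : bform k (fun j => (j == i)%:R) v = \sum_j k i j * v j.
Proof.
rewrite bformE (bigD1 i) //= eqxx mul1r.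
rewrite [X in _ + X]big1 ?addr0 // => j /negbTE ->.
by rewrite mul0r.
Qed.

Let mean (j : I) : R := #|I|%:R^-1.

Let spread_mean i : spread i
  = k i i - 2 * bform k (fun j => (j == i)%:R) mean + bform k mean mean.
Proof.
have -> : spread i = bform k (fun j => (j == i)%:R + (-1) * mean j)
                           (fun j => (j == i)%:R + (-1) * mean j).
  by congr bform; apply/funext => j; rewrite mulN1r.
have kii : bform k (fun j => (j == i)%:R) (fun j => (j == i)%:R) = k i i.
  rewrite bform_delta (bigD1 i) //= eqxx mulr1 [X in _ + X]big1 ?addr0 //.
  by move=> j /negbTE ->; rewrite mulr0.
by rewrite bform_line // kii; ring.
Qed.

Lemma spreadE i : spread i
  = k i i - 2 / #|I|%:R * (\sum_j k i j)
    + (#|I|%:R ^+ 2)^-1 * \sum_j \sum_l k j l.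
Proof.
rewrite spread_mean bform_delta -mulr_suml; congr (_ - _ + _).
  by rewrite mulrA mulrAC.
rewrite /bform mulr_sumr; apply: eq_bigr => j _; rewrite mulr_sumr.
apply: eq_bigr => l _; rewrite /mean expr2 invfM. ring.
Qed.

Lemma spread_ge0 i : 0 <= spread i.
Proof. by apply k_psd.2. Qed.

(** The left hand side is the moment of inertia of the points [e j] about their
    own centre of gravity, which minimises the moment of inertia; the right hand
    side is their moment about the centre of gravity of the whole sample. *)
Lemma scatter_le_spread (J : finType) (e : J -> I) : (0 < #|J|)%N ->
  \sum_j k (e j) (e j) - #|J|%:R^-1 * (\sum_j \sum_l k (e j) (e l))
  <= \sum_j spread (e j).
Proof.
move=> J0; set p : R := #|J|%:R; have p0 : 0 < p by rewrite ltr0n.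
pose s := transport e (fun=> 1 : R).
have ss : \sum_j \sum_l k (e j) (e l) = bform k s s.
  rewrite bform_transport; apply: eq_bigr => j _.
  by apply: eq_bigr => l _; rewrite mul1r mulr1.
have sm : \sum_j bform k (fun i => (i == e j)%:R) mean = bform k s mean.
  by rewrite bform_transportl; apply: eq_bigr => j _; rewrite bform_delta mul1r.
under [leRHS]eq_bigr do rewrite spread_mean.
rewrite big_split sumrB /= -mulr_sumr sm sumr_const -mulr_natr ss.
(* The difference of the two moments is p times this square. *)
have := k_psd.2 (fun i => mean i + (- p^-1) * s i).
rewrite bform_line // -(pmulr_rge0 _ p0) (bformC mean s k_psd).
have -> : p * (bform k mean mean + 2 * - p^-1 * bform k s mean
   + (- p^-1) ^+ 2 * bform k s s)
   = bform k mean mean * p - 2 * bform k s mean + p^-1 * bform k s s.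
  by field; rewrite gt_eqF.
by rewrite -/p; lra.
Qed.

End spread.

(** * Wide labellings shatter few points *)

Section wide_labelling.
Variables (R : realType) (I : finType) (k : I -> I -> R).

(** A labelling is given by the set A of its positive points. The inequality
    says that the centres of gravity of the positive and of the negative points
    among the [e j] are at distance at least 2 R gamma_h, for every e whose
    first half is positive and second half negative. Squaring, clearing the
    denominator, and replacing R^2 by each of the values of which it is the
    maximum keeps it meaningful for gamma_1 = +oo and makes the condition a
    finite conjunction. *)
Definition wide (h : nat) (A : {set I}) : Prop :=
  (exists i, 0 < spread k i) /\
  forall e : {ffun 'I_h.+1 -> I},
    (forall j, (e j \in A) = (j < h.+1./2)%N) ->
    forall i, 4 * spread k i
      <= inv_gamma_sq R h
         * bform (fun j l => k (e j) (e l))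
                 (@contrast R h.+1) (@contrast R h.+1).

Hypothesis k_psd : psd k.

(** If B has h + 1 points, some way of splitting them brings the two centres of
    gravity at a squared distance at most 4 gamma_(h+1)^2 R^2. Were B shattered,
    some wide labelling would realise that splitting, and the distance would be
    at least 2 gamma_h R > 2 gamma_(h+1) R. *)
Lemma wide_not_shattered (h : nat) (F : {set {set I}}) (B : {set I}) :
  (0 < h)%N -> (forall A, A \in F -> wide h A) -> shatters F B -> (#|B| <= h)%N.
Proof.
move=> h0 Fw /shattersP shB; rewrite leqNgt; apply/negP => hB.
pose e0 (j : 'I_h.+1) : I := enum_val (widen_ord hB j).
have e0_inj : injective e0.
  by move=> j l /enum_val_inj /(congr1 val) /= jl; apply/val_inj.
have e0B j : e0 j \in B by exact: enum_valP.
have p1 : (1 < h.+1)%N by [].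
have half_lt : (0 < h.+1 - h.+1./2)%N by lia.
have cJ : (1 < #|'I_h.+1|)%N by rewrite card_ord.
have [s] := exists_perm_bform_le (fun j l => k (e0 j) (e0 l))
                                 (sum_contrast R p1) cJ.
rewrite card_ord sum_contrast_sq // => hs.
pose e : {ffun 'I_h.+1 -> I} := [ffun j => e0 ((s^-1)%g j)].
have CB : [set e j | j : 'I_h.+1 & (j < h.+1./2)%N]%SET \subset B.
  by apply/fintype.subsetP => i /imsetP[j _ ->]; rewrite ffunE; exact: e0B.
have [A AF AB] := shB _ CB.
have [[i1 i1_gt0] /(_ e) wA] := Fw A AF.
have eA j : (e j \in A) = (j < h.+1./2)%N.
  have eB : e j \in B by rewrite ffunE.
  have -> : (e j \in A) = (e j \in A :&: B) by rewrite inE eB andbT.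
  rewrite AB mem_imset ?inE // => x y; rewrite !ffunE => /e0_inj.
  exact: perm_inj.
pose i0 : I := [arg max_(i > i1) spread k i]%O.
have i0_max i : spread k i <= spread k i0.
  by rewrite /i0; case: arg_maxP => // j _; apply.
have i0_gt0 : 0 < spread k i0 by exact: lt_le_trans (i0_max i1).
have {wA} wA := wA eA i0.
set b := bform _ _ _ in wA.
have bE : bform (fun j l => k (e0 j) (e0 l)) (@contrast R h.+1 \o s)
    (@contrast R h.+1 \o s) = b.
  rewrite /b /bform [RHS](reindex_perm s); apply: eq_bigr => j _.
  rewrite [RHS](reindex_perm s); apply: eq_bigr => l _.
  by rewrite !ffunE !permK.
rewrite {}bE in hs.
have scat : \sum_j k (e0 j) (e0 j) - h.+1%:R^-1 * (\sum_i \sum_j k (e0 i) (e0 j))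
    <= h.+1%:R * spread k i0.
  have := scatter_le_spread k_psd e0 (ltnW cJ).
  rewrite card_ord => /le_trans; apply.
  apply: le_trans (ler_sum _ (fun j _ => i0_max (e0 j))) _.
  by rewrite sumr_const card_ord mulr_natl.
set V := \sum_j k (e0 j) (e0 j) - _ in hs scat.
have GE := inv_gamma_sqE R (ltn0Sn h).
have Glt := inv_gamma_sq_ltS R h0; have G0 := inv_gamma_sq_ge0 R h0.
have x0 : 0 < (h.+1./2)%:R :> R by rewrite ltr0n half_gt0.
have y0 : 0 < (h.+1 - h.+1./2)%:R :> R by rewrite ltr0n.
have z0 : 0 < h.+1%:R - 1 :> R by rewrite -natr1 addrK ltr0n.
have q0 : 0 < h.+1%:R :> R by [].
move: x0 y0 z0 q0 wA hs scat GE Glt G0 i0_gt0; clearbody b V.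
move: (h.+1./2)%:R (h.+1 - h.+1./2)%:R (h.+1%:R) => x y q.
move: (inv_gamma_sq R h) (inv_gamma_sq R h.+1) (spread k i0) => G G' M.
move=> x0 y0 z0 q0 wA hs scat GE Glt G0 M0.
(* Here M is the largest spread, x and y are the sizes of the halves, and
   q = h + 1. The bounds give 4 M (q - 1) x y <= G q^2 M, while
   G q^2 < 4 (q - 1) x y. *)
have xy0 : 0 < x * y by rewrite mulr_gt0.
have h1 : (q - 1) * b * (x * y) <= q * (q * M).
  apply: le_trans (ler_wpM2l (ltW q0) scat).
  by rewrite -ler_pdivlMr // [leRHS]mulrAC.
have h2 : 4 * M * ((q - 1) * (x * y)) <= G * (q * (q * M)).
  have z1 : 0 <= (q - 1) * (x * y) by rewrite mulr_ge0 // ltW.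
  apply: le_trans (ler_wpM2r z1 wA) _.
  by rewrite -mulrA ler_wpM2l // mulrCA mulrA.
have h3 : G * (q * (q * M)) < G' * (q * (q * M)).
  by rewrite ltr_pM2r // !mulr_gt0.
have h4 : G' * (q * (q * M)) = 4 * M * ((q - 1) * (x * y)).
  have -> : G' * (q * (q * M)) = (G' * q ^+ 2) * M by ring.
  by rewrite GE; ring.
by move: h2; rewrite leNgt -h4 h3.
Qed.

End wide_labelling.

(** * Support vector machines produce wide labellings *)

Lemma linear_ge0_of_small_steps (R : realType) (t0 l q : R) : 0 < t0 ->
  (forall t, 0 < t -> t <= t0 -> 0 <= t * l + t ^+ 2 * q) -> 0 <= l.
Proof.
move=> t00 H; rewrite leNgt; apply/negP => l0.
have q1 : 0 < `|q| + 1 by rewrite ltr_wpDl.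
have s0 : 0 < - l / (`|q| + 1) by rewrite divr_gt0 // oppr_gt0.
pose t := Num.min t0 (- l / (`|q| + 1)).
have t_gt0 : 0 < t by rewrite lt_min t00.
have tle : t <= - l / (`|q| + 1) by rewrite ge_min lexx orbT.
have tq : t * (`|q| + 1) <= - l by rewrite -ler_pdivlMr.
have := H t t_gt0; rewrite ge_min lexx => /(_ isT).
rewrite expr2 -mulrA -mulrDr pmulr_rge0 // => lq.
have : t * q <= t * `|q| by rewrite ler_pM2l // ler_norm.
by move: tq; rewrite mulrDr mulr1; lra.
Qed.

Section svm_separation.
Variables (R : realType) (T : Type) (n : nat) (K : T * T -> R).
Variables (x : 'I_n -> T) (y : 'I_n -> bool).

Definition gram (i j : 'I_n) : R := K (x i, x j).

Hypothesis gram_psd : psd gram.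

(** In the coordinates [a i * label (y i)] the quadratic part of the dual
    objective is the form of the Gram matrix, and the balance constraint says
    that the coordinates sum to 0. *)
Definition signed (a : 'I_n -> R) (i : 'I_n) : R := a i * label (y i).

Let labelM i : label (y i) * label (y i) = 1 :> R.
Proof. by rewrite /label; case: (y i); rewrite ?mulr1 ?mulrNN ?mulr1. Qed.

Lemma dual_quadE a : dual_quad K x y a = bform gram (signed a) (signed a).
Proof.
by apply: eq_bigr => i _; apply: eq_bigr => j _; rewrite /signed /gram; ring.
Qed.

Lemma svm_scoreE a i : svm_score K x y a (x i) = \sum_j gram i j * signed a j.
Proof.
apply: eq_bigr => j _; rewrite /signed mulrC; congr (_ * _).
by rewrite -[LHS]/(gram j i) (gram_psd.1 j i).
Qed.

Lemma bform_score (J : finType) (e : J -> 'I_n) c a :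
  bform gram (transport e c) (signed a)
  = \sum_j c j * svm_score K x y a (x (e j)).
Proof.
by rewrite bform_transportl; apply: eq_bigr => j _; rewrite svm_scoreE.
Qed.

(** Moving a small mass from q to p in signed coordinates stays inside the dual
    constraints when p is a positive point or has positive weight, and q is a
    negative point or has positive weight. The derivative of the objective in
    this direction is nonnegative at a minimiser: this is the claim. All the
    complementary slackness conditions are of this form. *)
Lemma svm_kkt a p q : dual_minimizer K x y a ->
  y p \/ 0 < a p -> ~~ y q \/ 0 < a q ->
  label (y p) - label (y q)
  <= svm_score K x y a (x p) - svm_score K x y a (x q).
Proof.
move=> [[a_ge0 a_bal] a_min] yp yq.
have [->|pq] := eqVneq p q; first by rewrite !subrr.
pose v (i : 'I_n) : R := (i == p)%:R - (i == q)%:R.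
have sum_v (F : 'I_n -> R) : \sum_i v i * F i = F p - F q.
  rewrite (eq_bigr (fun i => (i == p)%:R * F i - (i == q)%:R * F i)) => [|i _].
    rewrite sumrB (bigD1 p) //= eqxx mul1r big1 => [|i /negbTE ->]; last first.
      by rewrite mul0r.
    rewrite addr0; congr (_ - _).
    rewrite (bigD1 q) //= eqxx mul1r big1 ?addr0 // => i /negbTE ->.
    by rewrite mul0r.
  by rewrite mulrBl.
have [t0 [t00 tp tq]] : exists t0 : R,
    [/\ 0 < t0, ~~ y p -> t0 <= a p & y q -> t0 <= a q].
  have pos i (b : bool) :
      (b \/ 0 < a i) -> exists2 t : R, 0 < t & ~~ b -> t <= a i.
    by case: b => -[]// h; [exists 1|exists 1|exists (a i)].
  have [t1 t10 h1] := pos p (y p) yp; have [t2 t20 h2] := pos q (~~ y q) yq.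
  exists (Num.min t1 t2); split=> [|/h1|]; first by rewrite lt_min t10.
    by apply: le_trans; rewrite ge_min lexx.
  by rewrite -{1}[y q]negbK => /h2; apply: le_trans; rewrite ge_min lexx orbT.
rewrite -subr_ge0 -(pmulr_rge0 _ (ltr0Sn R 1)).
apply: (@linear_ge0_of_small_steps _ t0 _ (bform gram v v)) => // t t_gt0 t_le.
pose a' i := (signed a i + t * v i) * label (y i).
have sa' : signed a' = fun i => signed a i + t * v i.
  by apply/funext => i; rewrite /signed /a' -mulrA labelM mulr1.
have a'E i : a' i = a i + t * (v i * label (y i)).
  by rewrite /a' mulrDl /signed -!mulrA labelM mulr1.
have a'_dual : dual_set y a'.
  split=> [i|]; last first.
    rewrite -[LHS]/(\sum_i signed a' i) sa' big_split /= -mulr_sumr.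
    have -> : \sum_i v i = 0.
      rewrite -[RHS](subrr 1) -(sum_v (fun=> 1)).
      by apply: eq_bigr => i _; rewrite mulr1.
    by rewrite mulr0 addr0; exact: a_bal.
  rewrite a'E /v; have := a_ge0 i.
  case: (eqVneq i p) => [->|ip].
    rewrite (negbTE pq) subr0 mul1r /label => h.
    case: ifP => [_|/negbT/tp tap]; first by rewrite mulr1 addr_ge0 // ltW.
    by rewrite mulrN1 subr_ge0; exact: le_trans tap.
  case: (eqVneq i q) => [->|iq] h; last by rewrite subr0 mul0r mulr0 addr0.
  rewrite sub0r mulN1r /label; case: ifP => [/tq taq|_].
    by rewrite mulrN1 subr_ge0; exact: le_trans taq.
  by rewrite opprK mulr1 addr_ge0 // ltW.
have : dual_obj K x y a <= dual_obj K x y a'.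
  rewrite -lee_fin a_min; apply: ereal_inf_lbound.
  by exists a'.
rewrite -subr_ge0 /dual_obj !dual_quadE sa' bform_line //.
have -> : \sum_i a' i = \sum_i a i + t * (label (y p) - label (y q)).
  rewrite (eq_bigr _ (fun i _ => a'E i)) big_split /= -mulr_sumr.
  by rewrite (sum_v (fun i => label (y i))).
have -> : bform gram (signed a) v
    = svm_score K x y a (x p) - svm_score K x y a (x q).
  rewrite bformC // bformE (sum_v (fun i => \sum_j gram i j * signed a j)).
  by rewrite !svm_scoreE.
by congr (_ <= _); ring.
Qed.

(** Taking (ip, im) in the optimality conditions, the scores of the two support
    vectors differ by at least 2, and the threshold is their midpoint; taking
    (i, ip) and (im, i), all other points lie beyond the support vector of
    their own label. *)
Lemma svm_separates a f : is_svm K x y a f -> exists b : R,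
  [/\ forall i, y i -> 1 <= svm_score K x y a (x i) - b,
      forall i, ~~ y i -> svm_score K x y a (x i) - b <= -1
    & forall i, f (x i) = y i].
Proof.
move=> [amin [im [ip [[aim aip] yim yip ->]]]].
exists (svm_threshold K x y a im ip).
have kkt := svm_kkt amin.
have gap : 2 <= svm_score K x y a (x ip) - svm_score K x y a (x im).
  have := kkt ip im; rewrite yim yip /label opprK => h.
  by apply: h; left.
have pos i : y i -> 1 <= svm_score K x y a (x i) - svm_threshold K x y a im ip.
  move=> yi; have := kkt i ip; rewrite yi yip subrr => h.
  have {}h := h (or_introl isT) (or_intror aip).
  by rewrite /svm_threshold; lra.
have neg i : ~~ y i ->
    svm_score K x y a (x i) - svm_threshold K x y a im ip <= -1.
  move=> yi; have := kkt im i; rewrite yim (negbTE yi) subrr => h.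
  have {}h := h (or_intror aim) (or_introl isT).
  by rewrite /svm_threshold; lra.
split=> // i; rewrite /sign_label; case: (boolP (y i)) => yi.
  by rewrite (le_trans ler01) // pos.
by apply/negbTE; rewrite -ltNge (le_lt_trans (neg i yi)) // ltrN10.
Qed.

Lemma spread_le_radius i : spread gram i <= sample_radius K x ^+ 2.
Proof.
set F := fun i : 'I_n => K (x i, x i) - 2 / n%:R * \sum_(j < n) K (x i, x j).
have Fi : F i <= sup (range F).
  apply: ub_le_sup; last by exists i.
  exists (\big[Num.max/F i]_j F j) => _ [j _ <-].
  exact: le_bigmax.
have le : spread gram i <= sup (range F)
    + (n%:R ^+ 2)^-1 * \sum_(j < n) \sum_(l < n) K (x j, x l).
  by rewrite spreadE // card_ord lerD2r.
by rewrite /sample_radius sqr_sqrtr // (le_trans (spread_ge0 gram_psd i)).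
Qed.

(** The case of a zero inverse margin is that of h = 1: the product with +oo is
    then finite only if the radius is 0. *)
Lemma radius_margin_le h a : (0 < h)%N ->
  ((sample_radius K x)%:E * gamma_ h <= svm_margin K x y a)%E ->
  0 < dual_quad K x y a ->
  sample_radius K x ^+ 2 * dual_quad K x y a <= inv_gamma_sq R h.
Proof.
move=> h0; set r := sample_radius K x; set Q := dual_quad K x y a => rQ Q0.
have r0 : 0 <= r by rewrite sqrtr_ge0.
have sQ0 : 0 < Num.sqrt Q by rewrite sqrtr_gt0.
move: rQ; rewrite /svm_margin -/Q.
have -> : gamma_ h = ((Num.sqrt (inv_gamma_sq R h))%:E^-1)%E by [].
have G0 := inv_gamma_sq_ge0 R h0.
rewrite [X in (_ <= X)%E]inver gt_eqF //.
have [->|Gn0] := eqVneq (inv_gamma_sq R h) 0.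
  rewrite sqrtr0 inve0; have [->|rn0] := eqVneq r 0.
    by rewrite expr0n mul0r.
  have rgt0 : 0 < r by rewrite lt_neqAle eq_sym rn0.
  by rewrite gt0_muley ?lte_fin // leye_eq.
have Ggt0 : 0 < inv_gamma_sq R h by rewrite lt_neqAle eq_sym Gn0.
have sG0 : 0 < Num.sqrt (inv_gamma_sq R h) by rewrite sqrtr_gt0.
rewrite inver gt_eqF // -EFinM lee_fin ler_pdivrMr // mulrC ler_pdivlMr // => le.
rewrite -(sqr_sqrtr (ltW Q0)) -[leRHS]sqr_sqrtr // -exprMn.
by rewrite lerXn2r // nnegrE // ?mulr_ge0 // ltW.
Qed.

End svm_separation.

(** By the Cauchy-Schwarz inequality, a separating direction of squared norm Q
    and functional margin 1 puts the centres of gravity of any two groups of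
    opposite labels at squared distance at least 4 / Q, and the margin condition
    says that R^2 Q is at most the inverse square of gamma_h. *)
Lemma margin_class_wide (R : realType) (T : Type) (n h : nat) (K : T * T -> R)
    (x : 'I_n -> T) (f : T -> bool) :
  psd (gram K x) -> (0 < h)%N -> margin_class K x h f ->
  exists2 A : {set 'I_n}, wide (gram K x) h A & forall i, f (x i) = (i \in A).
Proof.
move=> k_psd h0 [y [a [yb sep svm marg]]].
have [b [pos neg fy]] := svm_separates k_psd svm.
exists [set i | y i]%SET; last by move=> i; rewrite fy inE.
set u := signed y a; set Q := bform (gram K x) u u.
have QE : dual_quad K x y a = Q by exact: dual_quadE.
have [[ip yip] [im yim]] := yb.
have gap : 2 <= svm_score K x y a (x ip) - svm_score K x y a (x im).
  have := pos ip; have := neg im; rewrite yip yim => /(_ isT) + /(_ isT).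
  lra.
have gapE :
    bform (gram K x) (centered R ip) u - bform (gram K x) (centered R im) u
    = svm_score K x y a (x ip) - svm_score K x y a (x im).
  rewrite !bformE -sumrB !svm_scoreE //.
  rewrite (eq_bigr (fun i => (i == ip)%:R * \sum_j gram K x i j * u j
     - (i == im)%:R * \sum_j gram K x i j * u j)).
    by rewrite sumrB -!bformE !bform_delta.
  by move=> i _; rewrite /centered; ring.
(* If all points coincided in feature space, the scores would be equal. *)
have far : exists i, 0 < spread (gram K x) i.
  apply: contrapT => /forallNP H.
  have s0 i : spread (gram K x) i = 0.
    apply/eqP; rewrite eq_le spread_ge0 // andbT leNgt; apply/negP/H.
  have z i : bform (gram K x) (centered R i) u = 0.
    have := cauchy_schwarz (centered R i) u k_psd.
    rewrite -[bform _ (centered _ _) (centered _ _)]/(spread (gram K x) i).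
    rewrite s0 mul0r.
    by move=> h2; apply/eqP; rewrite -(sqrf_eq0 (bform _ _ _)) eq_le h2 sqr_ge0.
  by move: gap; rewrite -gapE !z subrr; lra.
split=> // e eA i.
have p1 : (1 < h.+1)%N by [].
have sep_e : 2 <= bform (gram K x) (transport e (@contrast R h.+1)) u.
  rewrite bform_score //; apply: (contrast_separated p1 (b := b)) => j hj.
    by apply: pos; have := eA j; rewrite inE hj.
  by apply: neg; have := eA j; rewrite inE ltnNge hj => ->.
set D := bform _ (@contrast R h.+1) _.
have cs : 4 <= D * Q.
  have := cauchy_schwarz (transport e (@contrast R h.+1)) u k_psd.
  rewrite bform_transport -/D; apply: le_trans.
  by rewrite (_ : 4 = 2 ^+ 2 :> R) ?lerXn2r ?nnegrE ?(le_trans _ sep_e) //; ring.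
have D0 : 0 <= D by rewrite /D -bform_transport; apply k_psd.2.
have Q_gt0 : 0 < Q.
  have Q0 : 0 <= Q by apply k_psd.2.
  by rewrite lt_neqAle Q0 andbT; apply/eqP => Qz; move: cs; rewrite -Qz; lra.
have rQ := radius_margin_le h0 marg; rewrite QE in rQ; have {}rQ := rQ Q_gt0.
have si := spread_le_radius k_psd i.
have s0 := spread_ge0 k_psd i.
rewrite [leRHS]mulrC; apply: le_trans (ler_wpM2l D0 rQ).
rewrite [leRHS]mulrCA [leRHS]mulrC; apply: le_trans (ler_wpM2r s0 cs) _.
by rewrite ler_wpM2l // mulr_ge0 // ltW.
Qed.

(** * Column shifts and the deviation inequality on an orbit *)

Section equivariance.
Variables (R : realType) (I : finType) (k : I -> I -> R) (s : {perm I}).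

Lemma spread_perm i : spread (fun i j => k (s i) (s j)) i = spread k (s i).
Proof.
rewrite /spread /bform [RHS](reindex_perm s); apply: eq_bigr => j _.
rewrite [RHS](reindex_perm s); apply: eq_bigr => l _.
by rewrite /centered !(inj_eq perm_inj).
Qed.

Lemma wide_perm h (A : {set I}) :
  wide (fun i j => k (s i) (s j)) h A -> wide k h (s @: A)%SET.
Proof.
move=> [[i0 i0_gt0] wA]; split; first by exists (s i0); rewrite -spread_perm.
move=> e eA i.
have seA j : (s^-1%g (e j) \in A) = (e j \in s @: A)%SET.
  by rewrite -{2}(permKV s (e j)) mem_imset //; exact: perm_inj.
have := wA [ffun j => s^-1%g (e j)].
move=> /(_ _ (s^-1%g i)); rewrite spread_perm permKV.
rewrite (_ : bform (fun j l => k (s ([ffun j => s^-1%g (e j)] j))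
   (s ([ffun j => s^-1%g (e j)] l))) = bform (fun j l => k (e j) (e l))).
  by apply=> j; rewrite ffunE seA eA.
by congr bform; apply/funext => j; apply/funext => l; rewrite !ffunE !permKV.
Qed.

End equivariance.

Section shifts.
Variables k N : nat.
Local Notation index := 'I_(k.+1 * N).

Fact cell_subproof (i : 'I_N) (j : 'I_k.+1) : (i + j * N < k.+1 * N)%N.
Proof.
apply: (@leq_trans (j.+1 * N)); first by rewrite mulSn ltn_add2r.
by rewrite leq_mul2r ltn_ord orbT.
Qed.

(** The index of row j in column i: rows are the blocks of N indices, and the
    training indices are those of row 0. *)
Definition cell i j : index := Ordinal (cell_subproof i j).

Lemma cell_modn i j : (cell i j %% N = i)%N.
Proof. by rewrite /= addnC modnMDl modn_small. Qed.

Lemma sum_cell (V : nmodType) (F : index -> V) :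
  \sum_m F m = \sum_i \sum_j F (cell i j).
Proof.
case: (posnP N) => [N0|N_gt0].
  rewrite !big1 // => [[i hi] _|[m hm] _]; exfalso.
    by move: hi; rewrite N0.
  by move: hm; rewrite N0 muln0.
have colP (m : index) : (m %% N < N)%N by rewrite ltn_mod.
have rowP (m : index) : (m %/ N < k.+1)%N by rewrite ltn_divLR.
rewrite pair_bigA /=.
rewrite (reindex (fun ij : 'I_N * 'I_k.+1 => cell ij.1 ij.2)) //=.
exists (fun m => (Ordinal (colP m), Ordinal (rowP m))) => [[i j] _|m _].
  congr (_, _); apply: val_inj => /=; first by rewrite cell_modn.
  by rewrite addnC divnMDl // divn_small ?addn0.
by apply: val_inj; rewrite /= addnC -divn_eq.
Qed.

Lemma sum_first_row (V : nmodType) (F : index -> V) :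
  \sum_(m < k.+1 * N | (m < N)%N) F m = \sum_i F (cell i ord0).
Proof.
rewrite big_mkcond sum_cell; apply: eq_bigr => i _.
rewrite big_ord_recl /= mul0n addn0 ltn_ord big1 ?addr0 // => j _.
by rewrite ifN // -leqNgt mulSn addnCA leq_addr.
Qed.

Lemma tau_source_lt (i : nat) (m : index) : (tau_source k N i m < k.+1 * N)%N.
Proof.
rewrite /tau_source; case: ifP => // _; case: (ltnP m N) => mN; last first.
  by apply: leq_ltn_trans (leq_subr _ _) (ltn_ord m).
by apply: leq_trans (_ : N + k * N <= _)%N; rewrite ?ltn_add2r // mulSn.
Qed.

Definition tau_index (i : nat) (m : index) : index :=
  Ordinal (tau_source_lt i m).

Lemma tau_index_modn i m : (tau_index i m %% N = m %% N)%N.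
Proof.
rewrite /= /tau_source; case: ifP => // _; case: (ltnP m N) => mN.
  by rewrite addnC modnMDl.
by rewrite -[in RHS](subnK mN) modnDr.
Qed.

Lemma tau_index_inj i : injective (tau_index i).
Proof.
move=> m l ml; have col : (m %% N = l %% N)%N.
  by rewrite -(tau_index_modn i m) ml tau_index_modn.
apply: val_inj; move/(congr1 val): ml; rewrite /= /tau_source col.
have lt (x : index) : (x < N + k * N)%N by rewrite -mulSn.
case: ifP => // _; have := lt m; have := lt l.
by case: (ltnP l N); case: (ltnP m N); lia.
Qed.

Definition column_shift (i : nat) : {perm index} := perm (@tau_index_inj i).

Lemma column_shift_modn i m : (column_shift i m %% N = m %% N)%N.
Proof. by rewrite permE tau_index_modn. Qed.

Lemma column_shiftX_modn i j m : ((column_shift i ^+ j)%g m %% N = m %% N)%N.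
Proof.
by elim: j => [|j IH]; rewrite ?expg0 ?perm1 // expgSr permM column_shift_modn.
Qed.

Lemma column_shiftX_fix i j (m : index) :
  (m %% N != i)%N -> (column_shift i ^+ j)%g m = m.
Proof.
move=> mi; elim: j => [|j IH]; first by rewrite expg0 perm1.
rewrite expgSr permM IH permE; apply: val_inj.
by rewrite /= /tau_source (negbTE mi).
Qed.

(** The exponents 1, ..., k + 1, rather than 0, ..., k, give the rows
    k, ..., 0 without a boundary case. *)
Lemma column_shiftX_cell (i : 'I_N) (j : 'I_k.+1) :
  (column_shift i ^+ j.+1)%g (cell i ord0) = cell i (rev_ord j).
Proof.
apply: val_inj; case: j => j /= jk; rewrite subSS; elim: j jk => [|j IH] jk.
  rewrite expg1 permE /= /tau_source.
  by rewrite mul0n addn0 modn_small // eqxx ltn_ord subn0.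
rewrite expgSr permM permE /= /tau_source column_shiftX_modn cell_modn eqxx.
have {}IH := IH (ltnW jk); rewrite IH.
have -> : (k - j = (k - j.+1).+1)%N by lia.
by rewrite mulSn addnCA ltnNge leq_addr /= addKn.
Qed.

(** As [s i] ranges over a full period of the shift of column i, the family [s]
    brings any choice of one row in each column to the training indices. *)
Definition multishift (s : {ffun 'I_N -> 'I_k.+1}) : {perm index} :=
  (\prod_(i < N) column_shift i ^+ (s i).+1)%g.

Lemma multishift_cell s i : multishift s (cell i ord0) = cell i (rev_ord (s i)).
Proof.
rewrite -column_shiftX_cell /multishift.
have gen (r : seq 'I_N) (m : index) : uniq r -> (m %% N = i)%N ->
    (\prod_(l <- r) column_shift l ^+ (s l).+1)%g m
    = if i \in r then (column_shift i ^+ (s i).+1)%g m else m.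
  elim: r m => [|l r IH] m; first by rewrite big_nil perm1.
  move=> /= /andP[lr ur] mi.
  rewrite big_cons permM in_cons IH ?column_shiftX_modn //.
  case: (eqVneq i l) => [il|il] /=; first by rewrite il (negbTE lr).
  by rewrite (@column_shiftX_fix l) // mi.
rewrite gen ?index_enum_uniq ?cell_modn //.
by rewrite mem_index_enum.
Qed.

End shifts.

Section orbit_deviation.
Variables (R : realType) (k N : nat).
Local Notation index := 'I_(k.+1 * N).
Implicit Types err : index -> bool.

Definition train_err err : nat := (\sum_(i < N) err (cell i (@ord0 k)))%N.
Definition mean_err err : R := (\sum_m err m)%N%:R / (k.+1 * N)%:R.

(** With q = exp (- lambda / N), the failure for some lambda > 0 of the
    inequality between the error rates at confidence 1 / C. *)
Definition deviates (C : R) err : Prop :=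
  exists2 q : R, 0 < q < 1
    & C * (1 - mean_err err * (1 - q)) ^+ N < q ^+ train_err err.

Hypothesis N_gt0 : (0 < N)%N.

Lemma mean_err_perm err (s : {perm index}) : mean_err (err \o s) = mean_err err.
Proof. by rewrite /mean_err [in RHS](reindex_perm s). Qed.

Lemma mean_err_itv err : 0 <= mean_err err <= 1.
Proof.
rewrite divr_ge0 //= ler_pdivrMr ?ltr0n ?muln_gt0 // mul1r ler_nat.
rewrite -[leqRHS]card_ord -sum1_card; apply: leq_sum => m _; exact: leq_b1.
Qed.

(** Expanding the product over the columns of the sums over the rows gives the
    sum over all choices of one row in each column, which are the training
    rows of the shifted samples. *)
Lemma sum_multishift_le err (q : R) : 0 < q < 1 ->
  \sum_s q ^+ train_err (err \o multishift s)
  <= (k.+1 ^ N)%:R * (1 - mean_err err * (1 - q)) ^+ N.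
Proof.
move=> /andP[q0 q1].
have -> : \sum_s q ^+ train_err (err \o multishift s)
    = \prod_i \sum_j q ^+ err (cell i j).
  rewrite (eq_bigr (fun i => \sum_j q ^+ err (cell i (rev_ord j)))); last first.
    by move=> i _; rewrite (reindex_inj rev_ord_inj).
  rewrite bigA_distr_bigA; apply: eq_bigr => s _; rewrite /train_err expr_sum.
  by apply: eq_bigr => i _ /=; rewrite multishift_cell.
pose E (i : 'I_N) : R := \sum_j q ^+ err (cell i j).
have E0 i : 0 <= E i by apply: sumr_ge0 => j _; rewrite exprn_ge0 // ltW.
have NR : N%:R != 0 :> R by rewrite pnatr_eq0 -lt0n.
have EE : (\sum_i E i) / N%:R = k.+1%:R * (1 - mean_err err * (1 - q)).
  have qe (b : bool) : q ^+ b = 1 - b%:R * (1 - q).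
    by case: b => /=; [rewrite expr1 | rewrite expr0]; ring.
  rewrite -(sum_cell (fun m => q ^+ err m)) (eq_bigr _ (fun m _ => qe (err m))).
  rewrite sumrB -mulr_suml sumr_const card_ord -natr_sum /mean_err natrM.
  by field; rewrite NR addrC natr1 pnatr_eq0.
have [+ _] := @leif_AGM R 'I_N (pred_of_argType 'I_N) E (fun i _ => E0 i).
by rewrite card_ord EE exprMn natrX.
Qed.

(** The parameter q of the deviating shift with the most training errors works
    for all deviating shifts, since q <= 1 and the mean error is invariant.
    Markov's inequality for this single q gives the bound. *)
Lemma count_deviating C err : 0 < C ->
  C * #|[set s | `[< deviates C (err \o multishift s) >]]%SET|%:R
  <= (k.+1 ^ N)%:R.
Proof.
move=> C0; set B := [set s | _]%SET.
have [->|[s1 s1B]] := set_0Vmem B; first by rewrite cards0 mulr0.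
pose s0 := [arg max_(s > s1 in B) train_err (err \o multishift s)]%N.
have [s0B s0max] : s0 \in B /\ forall s, s \in B ->
    (train_err (err \o multishift s) <= train_err (err \o multishift s0))%N.
  by rewrite /s0; case: arg_maxnP.
move: (s0B); rewrite inE => /asboolP[q q01].
rewrite mean_err_perm; set Z := _ ^+ N => CZ.
have [q0 q1] := andP q01.
have Z0 : 0 < Z.
  rewrite exprn_gt0 //; have /andP[p0 p1] := mean_err_itv err.
  apply: (lt_le_trans q0); rewrite lerBrDl -lerBrDr ler_piMl // subr_ge0.
  exact: ltW.
rewrite -(ler_pM2r Z0); apply: le_trans (sum_multishift_le err q01).
rewrite mulrAC mulr_natr -sumr_const.
apply: (@le_trans _ _ (\sum_(s in B) q ^+ train_err (err \o multishift s))).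
  apply: ler_sum => s sB; apply: le_trans (ltW CZ) _.
  by rewrite ler_wiXn2l ?ltW ?s0max.
rewrite [leRHS](bigID (mem B)) /= lerDl sumr_ge0 // => s _.
by rewrite exprn_ge0 // ltW.
Qed.

End orbit_deviation.

(** * Invariance of the law and measurability *)

Section permuted_sample.
Variables (k N : nat) (d : measure_display) (T : measurableType d) (R : realType).
Local Notation index := 'I_(k.+1 * N).
Local Notation sample := (sample_space k N T).

Definition permute (s : {perm index}) (w : sample) : sample :=
  [tuple tnth w (s m) | m < (k.+1 * N)%N].

Lemma permuteM s t w : permute (s * t)%g w = permute s (permute t w).
Proof. by apply: eq_from_tnth => m; rewrite !tnth_mktuple permM. Qed.

Lemma tau_permute (i : 'I_N) (w : sample) :
  tau i w = permute (column_shift k N i) w.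
Proof.
apply: eq_from_tnth => m; rewrite !tnth_mktuple permE.
by rewrite [RHS](tnth_nth (tnth w m)).
Qed.

Lemma measurable_permute s : measurable_fun [set: sample] (permute s).
Proof.
apply/measurable_fun_tnthP => m.
rewrite (_ : _ \o _ = fun w : sample => tnth w (s m)); last first.
  by apply/funext => w /=; rewrite tnth_mktuple.
exact: measurable_tnth.
Qed.

Variable P : probability sample R.

Definition invariant_under (s : {perm index}) : Prop :=
  forall A : set sample, measurable A -> P (permute s @^-1` A) = P A.

Lemma invariant_under1 : invariant_under 1%g.
Proof.
have p1 w : permute 1%g w = w.
  by apply: eq_from_tnth => m; rewrite tnth_mktuple perm1.
by move=> A _; congr (P _); apply/seteqP; split=> w; rewrite /preimage /= p1.
Qed.

Lemma invariant_underM s t :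
  invariant_under s -> invariant_under t -> invariant_under (s * t)%g.
Proof.
move=> Ps Pt A mA.
rewrite (_ : _ @^-1` _ = permute t @^-1` (permute s @^-1` A)); last first.
  by apply/seteqP; split=> w /=; rewrite permuteM.
rewrite Pt ?Ps // -[X in measurable X]setTI.
exact: measurable_permute.
Qed.

Hypothesis P_exch : partially_exchangeable P.

Lemma invariant_under_multishift f : invariant_under (multishift f).
Proof.
apply: big_rec => [|i s _ Ps]; first exact: invariant_under1.
apply: invariant_underM => //; elim: (f i).+1 => [|j IH].
  by rewrite expg0; exact: invariant_under1.
rewrite expgS; apply: invariant_underM => // A mA.
rewrite -(P_exch i mA) /pushforward; congr (P _).
by apply/seteqP; split=> w /=; rewrite tau_permute.
Qed.

(** By invariance P B is the average over the shifts of the probabilities of the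
    shifted events, that is the expectation of the proportion of the shifts that
    send w into B. *)
Lemma prob_le_of_orbit_count (B : set sample) (eps : R) : measurable B ->
  (forall w, #|[set f | `[< B (permute (multishift f) w) >]]%SET|%:R
             <= eps * (k.+1 ^ N)%:R) ->
  (P B <= eps%:E)%E.
Proof.
move=> mB H.
pose F := {ffun 'I_N -> 'I_k.+1}.
pose pre (f : F) := permute (multishift f) @^-1` B.
have mpre f : measurable (pre f).
  by rewrite -[X in measurable X]setTI; exact: measurable_permute.
have cardF : #|F| = (k.+1 ^ N)%N by rewrite card_ffun !card_ord.
have mind f : measurable_fun [set: sample] (fun w => (\1_(pre f) w : R)%:E).
  by apply/measurable_EFinP; exact: measurable_indic.
have PfE f : P (pre f) = (\int[P]_(w in [set: sample]) (\1_(pre f) w)%:E)%E.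
  by rewrite integral_indic // setIT.
have le_int : (\sum_(f : F) P (pre f) <= (eps * (k.+1 ^ N)%:R)%:E)%E.
  rewrite (eq_bigr _ (fun f _ => PfE f)) -ge0_integral_sum //.
  apply: (@le_trans _ _ (\int[P]_(w in [set: sample])
      cst (eps * (k.+1 ^ N)%:R)%:E w)%E); last first.
    rewrite integral_cst //. rewrite [X in (_ * X)%E]probability_setT mule1 //.
  apply: ge0_le_integral => // [w _||w _].
  - by apply: sume_ge0 => f _; rewrite lee_fin.
  - exact: emeasurable_sum.
  rewrite sumEFin lee_fin; apply: le_trans (H w).
  rewrite -sum1_card natr_sum [leRHS]big_mkcond /=; apply: ler_sum => f _.
  rewrite indicE inE; case: asboolP => [Bf|nBf].
    by rewrite mem_set.
  by rewrite memNset.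
move: le_int; rewrite (eq_bigr (fun=> (fine (P B))%:E)) => [|f _]; last first.
  by rewrite fineK ?fin_num_measure //; exact: invariant_under_multishift.
rewrite sumEFin lee_fin sumr_const cardF -[leLHS]mulr_natr ler_pM2r; last first.
  by rewrite ltr0n expn_gt0.
by move=> le_eps; rewrite -[P B]fineK ?fin_num_measure.
Qed.

End permuted_sample.

Section measurable_wide.
Variables (R : realType) (d : measure_display) (S : measurableType d).

Lemma measurable_finite_forall (I : finType) (Q : I -> S -> Prop) :
  (forall i, measurable [set w | Q i w]) -> measurable [set w | forall i, Q i w].
Proof.
move=> mQ; rewrite (_ : [set _ | _] = \bigcap_(i in [set: I]) [set w | Q i w]).
  by apply: fin_bigcap_measurable => // ; exact: finite_finset.
by apply/seteqP; split=> w /= H i => [_|]; exact: H.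
Qed.

Lemma measurable_finite_exists (I : finType) (Q : I -> S -> Prop) :
  (forall i, measurable [set w | Q i w]) -> measurable [set w | exists i, Q i w].
Proof.
move=> mQ; rewrite (_ : [set _ | _] = \bigcup_(i in [set: I]) [set w | Q i w]).
  by apply: fin_bigcup_measurable => // ; exact: finite_finset.
by apply/seteqP; split=> w /= [i]; [exists i | move=> _; exists i].
Qed.

Lemma measurable_imply (p : Prop) (Q : S -> Prop) :
  measurable [set w | Q w] -> measurable [set w | p -> Q w].
Proof.
move=> mQ; have [hp|hp] := pselect p.
  rewrite (_ : [set _ | _] = [set w | Q w]) //.
  by apply/seteqP; split=> w /=; tauto.
rewrite (_ : [set _ | _] = setT) //; apply/seteqP; split=> w //= _ /hp.
Qed.

Lemma measurable_bform (I : finType) (g : S -> I -> I -> R) u v :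
  (forall i j, measurable_fun [set: S] (fun w => g w i j)) ->
  measurable_fun [set: S] (fun w => bform (g w) u v).
Proof.
move=> mg; apply: measurable_sum => i; apply: measurable_sum => j.
by apply: measurable_funM => //; apply: measurable_funM.
Qed.

Lemma measurable_wide (I : finType) (g : S -> I -> I -> R) h (A : {set I}) :
  (forall i j, measurable_fun [set: S] (fun w => g w i j)) ->
  measurable [set w | wide (g w) h A].
Proof.
move=> mg; rewrite (_ : [set _ | _] = [set w | exists i, 0 < spread (g w) i]
  `&` [set w | forall e : {ffun 'I_h.+1 -> I},
    (forall j, (e j \in A) = (j < h.+1./2)%N) -> forall i, 4 * spread (g w) i
      <= inv_gamma_sq R h * bform (fun j l => g w (e j) (e l))
                                  (@contrast R h.+1) (@contrast R h.+1)]) //.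
have mspread i : measurable_fun [set: S] (fun w => spread (g w) i).
  exact: measurable_bform.
apply: measurableI.
  apply: measurable_finite_exists => i; rewrite -[X in measurable X]setTI.
  have lt0 := measurable_fun_ltr (measurable_cst (0 : R)) (mspread i).
  exact: (lt0 measurableT [set true]).
apply: measurable_finite_forall => e; apply: measurable_imply.
apply: measurable_finite_forall => i; rewrite -[X in measurable X]setTI.
apply: measurable_fun_le => //; first exact: measurable_funM.
by apply: measurable_funM => //; exact: measurable_bform.
Qed.

End measurable_wide.

(** * Union bound over wide labellings *)

Lemma card_bigcup_le (I S : finType) (Q : pred I) (F : I -> {set S}) :
  (#|\bigcup_(i | Q i) F i|%SET <= \sum_(i | Q i) #|F i|)%N.
Proof.
elim/big_rec2: _ => [|i m A _ le_mA]; first by rewrite cards0.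
by apply: leq_trans (leq_card_setU _ _) _; rewrite leq_add2l.
Qed.

Section deviation_event.
Variables (R : realType) (k N : nat) (d : measure_display) (T : measurableType d).
Variables (K : T * T -> R) (eps : R).
Local Notation index := 'I_(k.+1 * N).
Local Notation sample := (sample_space k N T).
Local Notation n := (k.+1 * N)%N.

(** The exponential of N times the deviation term of the bound at level h. *)
Definition threshold (h : nat) : R :=
  (expR 1 * n%:R / h%:R) ^+ h * (h * h.+1)%:R / eps.

Definition errors (A : {set index}) (w : sample) (m : index) : bool :=
  (m \in A) != obs_label w m.

Definition deviation_event : set sample :=
  [set w | exists (h : 'I_N) (A : {set index}),
     wide (gram K (pattern w)) h.+1 A /\ deviates (threshold h.+1) (errors A w)].

Hypothesis K_kernel : positive_kernel K.

Lemma psd_gram (w : sample) : psd (gram K (pattern w)).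
Proof.
have [_ sym pos] := K_kernel.
by split=> [i j|u]; [exact: sym | exact: pos].
Qed.

Lemma measurable_gram (i j : index) :
  measurable_fun [set: sample] (fun w => gram K (pattern w) i j).
Proof.
have [mK _ _] := K_kernel.
have mp m : measurable_fun [set: sample] (fun w : sample => pattern w m).
  by apply: (measurableT_comp measurable_fst); exact: measurable_tnth.
apply: (measurableT_comp mK (g := fun w : sample => (pattern w i, pattern w j))).
exact: measurable_fun_pair.
Qed.

Lemma measurable_obs_label (m : index) (b : bool) :
  measurable [set w : sample | obs_label w m = b].
Proof.
have ml : measurable_fun [set: sample] (fun w : sample => obs_label w m).
  by apply: (measurableT_comp measurable_snd); exact: measurable_tnth.
rewrite -[X in measurable X]setTI.
exact: (ml measurableT [set b]).
Qed.

(** The labels take finitely many values, and only wideness depends on the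
    patterns. *)
Lemma measurable_deviation_event : measurable deviation_event.
Proof.
apply: measurable_finite_exists => h; apply: measurable_finite_exists => A.
apply: measurableI.
  by apply: measurable_wide => i j; exact: measurable_gram.
rewrite [X in measurable X](_ : _ = [set w | exists y : {ffun index -> bool},
    deviates (threshold h.+1) (fun m => (m \in A) != y m)
    /\ forall m, obs_label w m = y m]); last first.
  apply/seteqP; split=> w /=.
    move=> dev; exists [ffun m => obs_label w m].
    split=> [|m]; last by rewrite ffunE.
    by congr (deviates _ _): dev; apply/funext => m; rewrite ffunE.
  move=> [y [dev wy]]; congr (deviates _ _): dev.
  by apply/funext => m; rewrite /errors wy.
apply: measurable_finite_exists => y.
have my : measurable [set w : sample | forall m, obs_label w m = y m].
  by apply: measurable_finite_forall => m; exact: measurable_obs_label.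
have [dev|ndev] := pselect (deviates (threshold h.+1) (fun m => (m \in A) != y m)).
  by congr (measurable _): my; apply/seteqP; split=> w /=; tauto.
by rewrite (_ : [set _ | _] = set0) //; apply/seteqP; split=> w //= [/ndev].
Qed.

Hypotheses (N_gt0 : (0 < N)%N) (eps_gt0 : 0 < eps).

Lemma sum_inv_pronic_le1 (m : nat) :
  \sum_(h < m) ((h.+1 * h.+2)%:R : R)^-1 <= 1.
Proof.
have -> : \sum_(h < m) ((h.+1 * h.+2)%:R : R)^-1 = 1 - m.+1%:R^-1.
  elim: m => [|m IH]; first by rewrite big_ord0 invr1 subrr.
  rewrite big_ord_recr /= IH natrM -[m.+2%:R]natr1; field.
  by rewrite [1 + _]addrC !natr1 !pnatr_eq0.
by rewrite lerBlDr lerDl invr_ge0.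
Qed.

Lemma threshold_gt0 h : (0 < h)%N -> 0 < threshold h.
Proof.
move=> h0; rewrite /threshold divr_gt0 // mulr_gt0 ?ltr0n ?muln_gt0 ?h0 //.
by rewrite exprn_gt0 // divr_gt0 ?mulr_gt0 ?expR_gt0 ?ltr0n ?muln_gt0.
Qed.

Lemma card_wide_le (w : sample) (h : nat) : (0 < h <= N)%N ->
  #|[set A | `[< wide (gram K (pattern w)) h A >]]%SET|%:R
  <= (expR 1 * n%:R / h%:R) ^+ h :> R.
Proof.
move=> /andP[h0 hN].
have hn : (0 < h <= n)%N by rewrite h0 (leq_trans hN) // leq_pmull.
apply: le_trans (sum_binomial_le_exp R hn); rewrite ler_nat.
have := @sauer_shelah index [set A | `[< wide (gram K (pattern w)) h A >]]%SET h.
rewrite card_ord; apply => B; apply: (wide_not_shattered (psd_gram w)) => // A.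
by rewrite inE => /asboolP.
Qed.

(** If A is wide for the sample shifted by t, then [t @: A] is wide for the
    sample itself, with errors read along t. So only the wide labellings of w
    enter the union bound, whatever the shift. *)
Lemma orbit_count_deviation_event (w : sample) :
  #|[set s | `[< deviation_event (permute (multishift s) w) >]]%SET|%:R
  <= eps * (k.+1 ^ N)%:R.
Proof.
pose W (h : nat) := [set A | `[< wide (gram K (pattern w)) h A >]]%SET.
pose D (h : nat) A := [set s | `[< deviates (threshold h)
                                   (errors A w \o @multishift k N s) >]]%SET.
have sub : [set s | `[< deviation_event (permute (multishift s) w) >]]%SET
    \subset (\bigcup_(h < N) \bigcup_(A in W h.+1) D h.+1 A)%SET.
  apply/fintype.subsetP => s; rewrite inE => /asboolP[h [A [wA dev]]].
  set t := multishift s in wA dev.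
  apply/bigcupP; exists h => //; apply/bigcupP; exists (t @: A)%SET.
    rewrite inE; apply/asboolP; apply: wide_perm.
    congr (wide _ _ _): wA; apply/funext => i; apply/funext => j.
    by rewrite /gram /pattern !tnth_mktuple.
  rewrite inE; apply/asboolP; congr (deviates _ _): dev; apply/funext => m.
  rewrite /errors /= mem_imset; last exact: perm_inj.
  by rewrite /obs_label tnth_mktuple.
apply: le_trans (_ : _ <= \sum_(h < N) \sum_(A in W h.+1) #|D h.+1 A|%:R) _.
  under eq_bigr do rewrite -natr_sum.
  rewrite -natr_sum ler_nat; apply: leq_trans (subset_leq_card sub) _.
  apply: leq_trans (card_bigcup_le _ _) _; apply: leq_sum => h _.
  exact: card_bigcup_le.
apply: (@le_trans _ _ (\sum_(h < N) eps * (k.+1 ^ N)%:R * ((h.+1 * h.+2)%:R)^-1)).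
  apply: ler_sum => h _; set M := (k.+1 ^ N)%:R.
  have C0 := threshold_gt0 (ltn0Sn h).
  have cD A : #|D h.+1 A|%:R <= M / threshold h.+1.
    by rewrite ler_pdivlMr // mulrC; exact: count_deviating.
  apply: le_trans (ler_sum _ (fun A _ => cD A)) _.
  rewrite sumr_const -[leLHS]mulr_natl.
  have e0 : 0 <= M / threshold h.+1 by rewrite divr_ge0 // ltW.
  apply: le_trans (ler_wpM2r e0 (card_wide_le w _)) _; first by rewrite ltn_ord.
  rewrite /threshold; set E := _ ^+ _; have E0 : 0 < E.
    by rewrite exprn_gt0 // divr_gt0 ?mulr_gt0 ?expR_gt0 ?ltr0n ?muln_gt0.
  have q0 : (h.+1 * h.+2)%:R != 0 :> R by rewrite pnatr_eq0 muln_eq0.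
  move: (_ * _)%:R q0 => q q0.
  rewrite le_eqVlt; apply/orP; left; apply/eqP; field.
  by rewrite q0 !gt_eqF.
rewrite -mulr_sumr ler_piMr ?sum_inv_pronic_le1 // mulr_ge0 // ltW //.
Qed.

End deviation_event.

(** * From counts of errors to the bound on the error rates *)

Section error_rates.
Variables (R : realType) (k N : nat) (T : Type).
Hypotheses (k_gt0 : (0 < k)%N) (N_gt0 : (0 < N)%N).
Variables (w : sample_space k N T) (f : T -> bool).
Let err (m : 'I_(k.+1 * N)) := f (pattern w m) != obs_label w m.

Lemma r1_train_err : r1 w f = (train_err err)%:R / N%:R :> R.
Proof.
rewrite /r1 mulrC -(natr_sum _ _ (fun m : 'I_(k.+1 * N) => (m < N)%N)).
by rewrite sum_first_row.
Qed.

Lemma r2_mean_err : r2 w f = k.+1%:R / k%:R * mean_err R err - r1 w f / k%:R.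
Proof.
rewrite /mean_err natr_sum (bigID (fun m : 'I_(k.+1 * N) => (m < N)%N)) /=.
rewrite /r1 /r2; under [X in _ = _ * ((_ + X) / _) - _]eq_bigl do rewrite -leqNgt.
set S1 := \sum_(_ < _ | (_ < N)%N) _; set S2 := \sum_(_ < _ | (N <= _)%N) _.
by rewrite !natrM -natr1; field; rewrite natr1 !pnatr_eq0 -!lt0n k_gt0 N_gt0.
Qed.

End error_rates.

(** The N-th power of the exponential in the numerator is q ^ (number of
    training errors) divided by the threshold, for q = exp (- lambda / N). *)
Lemma mean_err_le_inf (R : realType) (k N h : nat) (eps : R)
    (err : 'I_(k.+1 * N) -> bool) :
  (0 < N)%N -> (0 < h)%N -> 0 < eps ->
  ~ deviates (threshold k N eps h) err ->
  mean_err R err <=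
    inf [set (1 - expR (- (lambda / N%:R * ((train_err err)%:R / N%:R))
                        - h%:R / N%:R * ln (expR 1 * (k.+1 * N)%:R / h%:R)
                        - (ln (h * h.+1)%:R - ln eps) / N%:R))
             / (1 - expR (- (lambda / N%:R)))
        | lambda in [set lambda : R | 0 < lambda]].
Proof.
move=> N0 h0 e0 ndev; set X := [set _ | _ in _].
apply: lb_le_inf; first by eexists; exists 1 => /=; [exact: ltr01 | reflexivity].
move=> _ [lambda /= l0 <-].
have NR : 0 < N%:R :> R by rewrite ltr0n.
set q := expR (- (lambda / N%:R)).
have q0 : 0 < q by exact: expR_gt0.
have q1 : q < 1 by rewrite expR_lt1 oppr_lt0 divr_gt0.
rewrite ler_pdivlMr ?subr_gt0 // lerBrDl -lerBrDr.
set z := 1 - _; set x := expR _.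
have z0 : 0 <= z.
  have /andP[p0 p1] := mean_err_itv R N0 err.
  rewrite subr_ge0; apply: le_trans (_ : 1 * (1 - q) <= _); last first.
    by rewrite mul1r gerBl ltW.
  by rewrite ler_wpM2r // subr_ge0 ltW.
rewrite -(ler_pXn2r N0) ?nnegrE ?expR_ge0 //.
have C0 := threshold_gt0 k N0 e0 h0.
have {ndev} : q ^+ train_err err <= threshold k N eps h * z ^+ N.
  rewrite leNgt; apply/negP => dev; apply: ndev.
  by exists q; rewrite ?q0.
rewrite mulrC -ler_pdivrMr //; apply: le_trans.
rewrite le_eqVlt; apply/orP; left; apply/eqP.
have hR : 0 < h%:R :> R by rewrite ltr0n.
have nR : 0 < (k.+1 * N)%:R :> R by rewrite ltr0n muln_gt0.
have b0 : 0 < expR 1 * (k.+1 * N)%:R / h%:R :> R.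
  by rewrite divr_gt0 ?mulr_gt0 ?expR_gt0.
have pq : 0 < (h * h.+1)%:R :> R by rewrite ltr0n muln_gt0 h0.
have -> : threshold k N eps h
    = expR (h%:R * ln (expR 1 * (k.+1 * N)%:R / h%:R)
            + ln (h * h.+1)%:R - ln eps).
  by rewrite !expRD expRN expRM_natl !lnK ?posrE.
rewrite /x /q -!expRM_natl -expRN -expRD; congr expR.
by field; rewrite gt_eqF.
Qed.

Theorem proposition3p16 (R : realType) (k N : nat) (k_gt0 : (0 < k)%N)
    (N_gt0 : (0 < N)%N) (d : measure_display) (T : measurableType d)
    (K : T * T -> R) (K_kernel : positive_kernel K)
    (eps : R) (eps_gt0 : 0 < eps) (eps_lt1 : eps < 1)
    (P : probability (sample_space k N T) R)
    (P_exch : partially_exchangeable P) :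
  with_probability_at_least P (1 - eps)
    [set w | forall (h : nat) (f : T -> bool),
       (1 <= h <= N)%N -> margin_class K (pattern w) h f ->
       r2 w f <=
         (k.+1%:R / k%:R) *
         inf [set (1 - expR (- (lambda / N%:R * r1 w f)
                             - h%:R / N%:R
                               * ln (expR 1 * (k.+1 * N)%:R / h%:R)
                             - (ln (h * h.+1)%:R - ln eps) / N%:R))
                  / (1 - expR (- (lambda / N%:R)))
             | lambda in [set lambda : R | 0 < lambda]]
         - r1 w f / k%:R].
Proof.
have mD := @measurable_deviation_event R k N d T K eps K_kernel.
exists (~` @deviation_event R k N d T K eps); split; first exact: measurableC.
  rewrite probability_setC // EFinB leeB //.
  apply: prob_le_of_orbit_count => // w.
  exact: orbit_count_deviation_event.
move=> w /= ndev h f /andP[h0 hN] fR.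
have [A wA fA] := margin_class_wide (psd_gram K_kernel w) h0 fR.
have errE : (fun m => f (pattern w m) != obs_label w m) = errors A w.
  by apply/funext => m; rewrite /errors fA.
rewrite r2_mean_err // errE lerD2r ler_wpM2l //.
rewrite r1_train_err errE; apply: mean_err_le_inf => // dev.
case: h h0 hN fR wA dev => // h _ hN _ wA dev.
by apply: ndev; exists (Ordinal hN), A.
Qed.
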